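(* Let $\mathbb{F}=\mathbb{R}$ or $\mathbb{C}$, and set $\alpha=1$ if $\mathbb{F}=\mathbb{R}$ and $\alpha=2$ if $\mathbb{F}=\mathbb{C}$. Let $n\ge1$, let $\mathcal{S}\subseteq\mathcal{S}'\subseteq\mathbb{F}^n$ be linear subspaces, let $p=\dim(\mathcal{S})$ and $q=\dim(\mathcal{S}')-\dim(\mathcal{S})$, and assume $q\le p$. Then $$\mathcal{M}_{\mathrm{sym}}(\mathcal{S},\mathcal{S}'):=\{A\in\mathrm{Sym}(n):\mathcal{S}+A\mathcal{S}=\mathcal{S}'\}$$ is a smooth embedded submanifold of $\mathrm{Sym}(n)$ (which is diffeomorphic to $\mathbb{R}^{\alpha n(n-1)/2+n}$) having dimension $\alpha\,\big(n(n-1)/2-p(n-p-q)\big)+n$.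
   Context: $A\mathcal{S}=\{Ax:x\in\mathcal{S}\}$. $\mathrm{Sym}(n)$ is the set of Hermitian matrices in $\mathbb{F}^{n\times n}$ (real symmetric if $\mathbb{F}=\mathbb{R}$), regarded as a real vector space with its standard smooth structure. All sets of matrices carry the subset topology. ''Manifold'' and ''dimension'' refer to real smooth manifolds. *)

(* Defs.v *)
From HB Require Import structures.
From mathcomp Require Import all_boot all_order all_algebra.
From mathcomp Require Import sesquilinear complex zify.
From mathcomp Require Import all_classical all_reals all_analysis.
Set Implicit Arguments.
Unset Strict Implicit.
Unset Printing Implicit Defensive.
Import Order.TTheory GRing.Theory Num.Theory.
Import numFieldNormedType.Exports.
Local Open Scope classical_set_scope.
Local Open Scope ring_scope.

Section Smooth.
Context {R : realType}.

(* [C_on k U f]: f is of class C^k on the open set U.  Between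
   finite-dimensional spaces, the only ones used here, this is the usual notion:
   requiring every directional derivative 'D_v f to be of class C^k amounts to
   requiring x |-> 'd f x to be of class C^k.  Only the restriction of f to U
   matters, since U is open. *)
Fixpoint C_on (V W : normedModType R) (k : nat) (U : set V) (f : V -> W) : Prop :=
  if k is k'.+1 then
    (forall x, U x -> differentiable f x) /\ (forall v, C_on k' U ('D_v f))
  else forall x, U x -> {for x, continuous f}.

Definition smooth_on (V W : normedModType R) (U : set V) (f : V -> W) : Prop :=
  forall k, C_on k U f.

Definition diffeomorphic (V W : normedModType R) : Prop :=
  exists (f : V -> W) (g : W -> V),
    [/\ cancel f g, cancel g f, smooth_on setT f & smooth_on setT g].

Record chart (V : normedModType R) (d : nat) := Chart {
  chart_dom : set V;
  chart_img : set 'rV[R]_d;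
  chart_map : V -> 'rV[R]_d;
  chart_inv : 'rV[R]_d -> V }.

(* c is a homeomorphism, with inverse chart_inv c, from a subset of M that is
   open for the subset topology of M onto an open subset of R^d. *)
Definition chart_of (V : normedModType R) (d : nat) (M : set V)
    (c : chart V d) : Prop :=
  [/\ exists2 O : set V, open O & chart_dom c = M `&` O,
      open (chart_img c),
      [/\ {homo chart_map c : x / chart_dom c x >-> chart_img c x},
          {homo chart_inv c : y / chart_img c y >-> chart_dom c y},
          (forall x, chart_dom c x -> chart_inv c (chart_map c x) = x) &
          (forall y, chart_img c y -> chart_map c (chart_inv c y) = y)],
      {within chart_dom c, continuous (chart_map c)} &
      {within chart_img c, continuous (chart_inv c)}].

Definition smooth_atlas (V : normedModType R) (d : nat) (M : set V)
    (A : set (chart V d)) : Prop :=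
  [/\ forall c, A c -> chart_of M c,
      forall x, M x -> exists2 c, A c & chart_dom c x &
      forall c c', A c -> A c' ->
        smooth_on (chart_img c `&` chart_inv c @^-1` chart_dom c')
                  (chart_map c' \o chart_inv c)].

(* M, with the subset topology, has a smooth structure of dimension d for which
   the inclusion of M in V is a smooth immersion (read in the charts, the
   inclusion is chart_inv).  The inclusion is then an embedding, as charts are
   homeomorphisms for the subset topology.  That M is Hausdorff and second
   countable is automatic for V finite-dimensional.  The empty set satisfies
   this for every d. *)
Definition embedded_submanifold (V : normedModType R) (M : set V) (d : nat)
    : Prop :=
  exists2 A : set (chart V d), smooth_atlas M A &
    forall c, A c ->
      smooth_on (chart_img c) (chart_inv c) /\
      (forall y, chart_img c y -> injective ('d (chart_inv c) y)).

End Smooth.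

Variant base_field := RealCase | ComplexCase.

Section Scalars.
Variables (R : realType) (k : base_field).

Definition scalars : numFieldType :=
  if k is ComplexCase then R[i] else R.

Definition real_degree : nat := if k is ComplexCase then 2 else 1.

End Scalars.

Definition conj_scalar (R : realType) (k : base_field) :
    scalars R k -> scalars R k :=
  match k return scalars R k -> scalars R k with
  | RealCase => fun x : R => x
  | ComplexCase => fun z : R[i] => Num.conj z
  end.

Definition of_real (R : realType) (k : base_field) : R -> scalars R k :=
  match k return R -> scalars R k with
  | RealCase => fun x => x
  | ComplexCase => fun x => x%:C%C
  end.

Definition abs_scalar (R : realType) (k : base_field) : scalars R k -> R :=
  match k return scalars R k -> R with
  | RealCase => fun x : R => `|x|
  | ComplexCase => fun z : R[i] => complex.Re `|z|
  end.

Section ScalarTheory.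
Variables (R : realType) (k : base_field).
Implicit Types (x y : scalars R k) (r : R).
Local Notation conj_scalar := (@conj_scalar R k).
Local Notation of_real := (@of_real R k).
Local Notation abs_scalar := (@abs_scalar R k).

Lemma conj_scalar_is_zmod_morphism : {morph conj_scalar : x y / x - y}.
Proof. by rewrite /conj_scalar; case: k => //= x y; rewrite rmorphB. Qed.

Lemma conj_scalar_of_realM r x :
  conj_scalar (of_real r * x) = of_real r * conj_scalar x.
Proof.
rewrite /conj_scalar /of_real; case: k x => //= x.
by rewrite rmorphM /=; congr (_ * _); exact: conjc_real.
Qed.

Lemma of_realD r s : of_real (r + s) = of_real r + of_real s.
Proof. by rewrite /of_real; case: k => //=; rewrite rmorphD. Qed.

Lemma of_realM r s : of_real (r * s) = of_real r * of_real s.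
Proof. by rewrite /of_real; case: k => //=; rewrite rmorphM. Qed.

Lemma of_real1 : of_real 1 = 1.
Proof. by rewrite /of_real; case: k. Qed.

Lemma abs_scalarD x y : abs_scalar (x + y) <= abs_scalar x + abs_scalar y.
Proof.
rewrite /abs_scalar; case: k x y => /= [x y|x y]; first exact: ler_normD.
by have /andP[_] : `|x + y| <= `|x| + `|y| := ler_normD x y.
Qed.

Lemma abs_scalar_of_realM r x : abs_scalar (of_real r * x) = `|r| * abs_scalar x.
Proof.
rewrite /abs_scalar /of_real; case: k x => /= [x|x]; first exact: normrM.
have /(congr1 (@complex.Re R))/= -> := normrM (r%:C%C : R[i]) x.
by case: x => a b /=; rewrite expr0n addr0 sqrtr_sqr mul0r subr0.
Qed.

Lemma abs_scalar_ge0 x : 0 <= abs_scalar x.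
Proof.
rewrite /abs_scalar; case: k x => /= [x|x]; first exact: normr_ge0.
by have /andP[_] : 0 <= `|x| := normr_ge0 x.
Qed.

Lemma abs_scalar_eq0 x : abs_scalar x = 0 -> x = 0.
Proof.
rewrite /abs_scalar; case: k x => /= [x /normr0_eq0//|x].
by case: x => a b /= h; apply: ComplexField.eq0_normC; rewrite /= h.
Qed.

End ScalarTheory.

Section Sym.
Variables (R : realType) (k : base_field) (n : nat).
Local Notation F := (scalars R k).

(* A = A^*, the conjugate transpose (just the transpose if F = R). *)
Definition is_hermitian : {pred 'M[F]_n} :=
  fun A => A \is hermitianmx n false (@conj_scalar R k).

Record Sym := MkSym { Sym_val :> 'M[F]_n; Sym_valP : Sym_val \in is_hermitian }.

HB.instance Definition _ := [isSub for Sym_val].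
HB.instance Definition _ := [Choice of Sym by <:].

Lemma hermitian_zmod_closed : zmod_closed is_hermitian.
Proof.
have E (A : 'M[F]_n) :
    (A \in is_hermitian) = (A == map_mx (@conj_scalar R k) A^T).
  by rewrite unfold_in is_hermitianmxE expr0 scale1r.
have c0 : @conj_scalar R k 0 = 0.
  by rewrite -[0 in LHS](subrr 0) conj_scalar_is_zmod_morphism subrr.
split=> [|A B]; rewrite !E.
  by apply/eqP/matrixP => i j; rewrite !mxE c0.
move=> /eqP/matrixP hA /eqP/matrixP hB; apply/eqP/matrixP => i j.
move: (hA i j) (hB i j); rewrite !mxE => -> ->.
by rewrite conj_scalar_is_zmod_morphism.
Qed.

HB.instance Definition _ := GRing.isZmodClosed.Build 'M[F]_n is_hermitian
  hermitian_zmod_closed.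
HB.instance Definition _ := [SubChoice_isSubZmodule of Sym by <:].

Lemma scale_hermitian (r : R) (A : Sym) :
  of_real k r *: (A : 'M[F]_n) \in is_hermitian.
Proof.
have /is_hermitianmxP/matrixP hA := Sym_valP A.
apply/is_hermitianmxP; rewrite expr0 scale1r; apply/matrixP => i j.
by move: (hA i j); rewrite expr0 scale1r !mxE => ->; rewrite conj_scalar_of_realM.
Qed.

Definition Sym_scale (r : R) (A : Sym) : Sym := MkSym (scale_hermitian r A).

Fact Sym_scaleA r s A : Sym_scale r (Sym_scale s A) = Sym_scale (r * s) A.
Proof. by apply: val_inj; rewrite /= of_realM scalerA. Qed.

Fact Sym_scale1 : left_id 1 Sym_scale.
Proof. by move=> A; apply: val_inj; rewrite /= of_real1 scale1r. Qed.

Fact Sym_scaleDr : right_distributive Sym_scale +%R.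
Proof. by move=> r A B; apply: val_inj; rewrite /= scalerDr. Qed.

Fact Sym_scaleDl A : {morph Sym_scale^~ A : r s / r + s}.
Proof. by move=> r s; apply: val_inj; rewrite /= of_realD scalerDl. Qed.

HB.instance Definition _ := GRing.Zmodule_isLmodule.Build R Sym
  Sym_scaleA Sym_scale1 Sym_scaleDr Sym_scaleDl.

(* Sym(n) is finite-dimensional, so every norm induces its standard topology and
   smooth structure. *)
Definition Sym_norm (A : Sym) : R := \sum_i \sum_j abs_scalar (Sym_val A i j).

Fact Sym_ler_normD A B : Sym_norm (A + B) <= Sym_norm A + Sym_norm B.
Proof.
rewrite /Sym_norm -big_split; apply: ler_sum => i _ /=.
rewrite -big_split; apply: ler_sum => j _ /=.
by rewrite mxE abs_scalarD.
Qed.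

Fact Sym_normrZ (r : R) A : Sym_norm (r *: A) = `|r| * Sym_norm A.
Proof.
rewrite /Sym_norm mulr_sumr; apply: eq_bigr => i _.
rewrite mulr_sumr; apply: eq_bigr => j _.
by rewrite mxE abs_scalar_of_realM.
Qed.

Fact Sym_normr0_eq0 A : Sym_norm A = 0 -> A = 0.
Proof.
move=> A0; apply: val_inj; apply/matrixP => i j; rewrite [RHS]mxE.
apply: abs_scalar_eq0.
have row_ge0 i' : true -> 0 <= \sum_j abs_scalar (Sym_val A i' j).
  by move=> _; apply: sumr_ge0 => j' _; exact: abs_scalar_ge0.
have rowi0 : \sum_j abs_scalar (Sym_val A i j) = 0.
  exact: (psumr_eq0P row_ge0 A0).
exact: (psumr_eq0P (fun j' _ => abs_scalar_ge0 (Sym_val A i j')) rowi0).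
Qed.

HB.instance Definition _ := Lmodule_isNormed.Build R Sym
  Sym_ler_normD Sym_normrZ Sym_normr0_eq0.

End Sym.

Section MSym.
Variables (R : realType) (k : base_field) (n : nat).
Local Notation F := (scalars R k).

Definition mulmx_image (A : 'M[F]_n) (S : {vspace 'cV[F]_n}) :
    {vspace 'cV[F]_n} :=
  (linfun (mulmx A : 'cV[F]_n -> 'cV[F]_n) @: S)%VS.

Definition Msym (S S' : {vspace 'cV[F]_n}) : set (Sym R k n) :=
  [set A | (S + mulmx_image A S)%VS = S'].

End MSym.

(* The natural-number subtractions in the dimension of Msym do not truncate. *)
Lemma dim_Msym_subn_exact (n p q : nat) :
  (p + q <= n)%N -> (p * (n - p - q) <= (n * n.-1)./2)%N.
Proof.
move=> pqn; rewrite -[leqLHS](doubleK) half_leq // -mul2n.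
apply: (@leq_trans (2 * (p * (n - p)))); first by rewrite !leq_mul2l leq_subr !orbT.
have [m ->] : exists m, n = p + m by exists (n - p)%N; lia.
rewrite addKn; have h := @nat_Cauchy p m.
case: (posnP (p + m)) => [|pm0]; nia.
Qed.

(* Main.v *)
(* Msym(S, S') is the intersection of the real-linear space
   L = {A : S + A S <= S'} with the open set where dim (S + A S) >= dim S', so a
   linear parametrization of L by R^d provides a single global chart.  If the
   rows of X are a basis of S and the columns of Y cut out S', then L is given by
   X A^T Y = 0.  As X Y = 0, the conjugated rows of X and the rows of Y^T are
   orthogonal to each other, so they are the first rows of an invertible W, and
   the congruence A |-> W A W^* turns L into the Hermitian matrices with a
   vanishing p x (n - p - q) off-diagonal block.
   A member of Msym(S, S') is a transpose of X^* C T + T^* C^* X, where the rows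
   of T complete those of X to a basis of S' and C has rank q. *)
From HB Require Import structures.
Require Import Defs.
From mathcomp Require Import all_boot all_order all_algebra.
From mathcomp Require Import sesquilinear complex zify.
From mathcomp Require Import all_classical all_reals all_analysis.
Set Implicit Arguments.
Unset Strict Implicit.
Unset Printing Implicit Defensive.
Import Order.TTheory GRing.Theory Num.Theory.
Import numFieldNormedType.Exports.
Local Open Scope classical_set_scope.
Local Open Scope ring_scope.

(** * Smoothness of linear maps, and submanifolds with one linear chart *)

Section LinearSmooth.
Context {R : realType}.
Implicit Types V W : normedModType R.

Lemma continuous_sumr V W (I : Type) (r : seq I) (P : pred I)
    (f : I -> V -> W) :
  (forall i, P i -> continuous (f i)) ->
  continuous (fun x => \sum_(i <- r | P i) f i x).
Proof.
move=> cf; elim: r => [|i r IH].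
  rewrite (_ : (fun _ => _) = cst 0); first exact: cst_continuous.
  by apply/funext => x; rewrite big_nil.
rewrite (_ : (fun _ => _) = fun x =>
    (if P i then f i x else 0) + \sum_(j <- r | P j) f j x); last first.
  by apply/funext => x; rewrite big_cons; case: ifP => // _; rewrite add0r.
move=> x; apply: cvgD; last exact: IH.
by case: (boolP (P i)) => [Pi|_]; [exact: cf|exact: cvg_cst].
Qed.

(** Expanding in the standard basis makes [f] a finite sum of coordinate functions times fixed
    vectors. *)
Lemma linear_row_continuous V (d : nat) (f : {linear 'rV[R]_d -> V}) :
  continuous f.
Proof.
rewrite (_ : GRing.Linear.sort f =
    fun v : 'rV[R]_d => \sum_j v ord0 j *: f (delta_mx ord0 j)); last first.
  apply/funext => v; rewrite {1}(row_sum_delta v) linear_sum.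
  by apply: eq_bigr => j _; rewrite linearZ.
apply: continuous_sumr => j _ v.
by apply: continuousZr_tmp; exact: coord_continuous.
Qed.

Lemma C_on_cst V W k (U : set V) (w : W) : C_on k U (cst w : V -> W).
Proof.
elim: k U w => [U w x _|k IH U w /=]; first exact: cvg_cst.
split=> [x _|v]; first exact: differentiable_cst.
rewrite (_ : 'D_v (cst w) = cst 0); first exact: IH.
by apply/funext => x; rewrite derive_cst.
Qed.

(** The derivative along [v] is the constant [f v], so everything beyond the first order reduces to
    constant maps. *)
Lemma linear_smooth_on V W (U : set V) (f : {linear V -> W}) :
  continuous f -> smooth_on U f.
Proof.
move=> cf [|k] /=; first by move=> x _; exact: cf.
split=> [x _|v]; first exact: linear_differentiable.
rewrite (_ : 'D_v f = cst (f v)); first exact: C_on_cst.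
apply/funext => x; rewrite deriveE ?diff_lin//.
exact: linear_differentiable.
Qed.

Lemma linear_diffeomorphic V W (f : {linear V -> W}) (g : {linear W -> V}) :
  continuous f -> continuous g -> cancel f g -> cancel g f ->
  diffeomorphic V W.
Proof. by move=> cf cg fK gK; exists f, g; split=> //; exact: linear_smooth_on. Qed.

(** Since the left inverse [f] of [g] is defined and continuous on all of [V], the pair is a global
    chart whose only transition map is [f \o g]. A linear map is its own differential, so the
    immersion condition is the injectivity of [g]. *)
Lemma linear_embedded_submanifold V (d : nat) (f : {linear V -> 'rV[R]_d})
    (g : {linear 'rV[R]_d -> V}) (O : set V) :
  continuous f -> cancel g f -> open O ->
  embedded_submanifold (range g `&` O) d.
Proof.
move=> cf gK openO; have cg := @linear_row_continuous _ _ g.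
pose c := Chart (range g `&` O) (g @^-1` O) f g.
have chart_c : chart_of (range g `&` O) c.
  split=> /=.
  - by exists O => //; rewrite -setIA setIid.
  - by apply: open_comp => // x _; exact: cg.
  - split=> //=.
    + by move=> _ [[v _ <-] Ov]; rewrite /= gK.
    + by move=> v Ov; split=> //; exists v.
    + by move=> _ [[v _ <-] _]; rewrite gK.
  - exact: continuous_subspaceT.
  - exact: continuous_subspaceT.
exists [set c] => [|_ ->]; last first.
  split; first exact: linear_smooth_on.
  by move=> v _; rewrite /= diff_lin//; exact: can_inj gK.
split=> [_ ->//|x Mx|_ _ -> ->]; first by exists c.
have cfg : continuous (f \o g).
  by move=> v; apply: continuous_comp; [exact: cg|exact: cf].
exact: (linear_smooth_on _ (f := f \o g)).
Qed.

End LinearSmooth.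

(** * Real coordinates and conjugation on the scalars *)

Section ScalarCoord.
Variables (R : realType) (k : base_field).
Local Notation F := (scalars R k).
Local Notation conjF := (@conj_scalar R k).
Local Notation of_real := (@of_real R k).
Implicit Types (x y : F) (r : R).

Definition scalar_re : F -> R :=
  match k return scalars R k -> R with
  | RealCase => fun x : R => x
  | ComplexCase => @complex.Re R
  end.

Definition scalar_coord : 'I_(real_degree k) -> F -> R :=
  match k return 'I_(real_degree k) -> scalars R k -> R with
  | RealCase => fun _ (x : R) => x
  | ComplexCase => fun c (x : R[i]) =>
      if c == ord0 then complex.Re x else complex.Im x
  end.

Definition scalar_of_coord : ('I_(real_degree k) -> R) -> F :=
  match k return ('I_(real_degree k) -> R) -> scalars R k with
  | RealCase => fun u => u ord0
  | ComplexCase => fun u => Complex (u ord0) (u ord_max)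
  end.

Lemma scalar_re_is_scalar r x y :
  scalar_re (of_real r * x + y) = r * scalar_re x + scalar_re y.
Proof.
rewrite /scalar_re /Defs.of_real; case: k x y => //= - [a b] [c d] /=.
by rewrite mul0r subr0.
Qed.

Lemma scalar_reK r : scalar_re (of_real r) = r.
Proof. by rewrite /scalar_re /Defs.of_real; case: k. Qed.

Lemma ler_abs_re x : `|scalar_re x| <= abs_scalar x.
Proof.
rewrite /scalar_re /abs_scalar; case: k x => //= - [a b] /=.
by rewrite -[leLHS]sqrtr_sqr ler_wsqrtr// lerDl sqr_ge0.
Qed.

Lemma conj_of_real r : conjF (of_real r) = of_real r.
Proof. by rewrite /conj_scalar /Defs.of_real; case: k => //=; exact: conjc_real. Qed.

Lemma conj_scalarK : involutive conjF.
Proof. by rewrite /conj_scalar; case: k => //=; exact: conjCK. Qed.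

(** For the diagonal of a Hermitian matrix, which is thus described by one real number per entry. *)
Lemma conj_scalar_fixed x : conjF x = x -> of_real (scalar_re x) = x.
Proof.
rewrite /conj_scalar /scalar_re /Defs.of_real; case: k x => //= - [a b] /=.
by move=> [] /eqP; rewrite eqNr => /eqP ->.
Qed.

Lemma scalar_coord_is_scalar c r x y :
  scalar_coord c (of_real r * x + y) = r * scalar_coord c x + scalar_coord c y.
Proof.
rewrite /scalar_coord /Defs.of_real; case: k c x y => //= c [a b] [a' b'] /=.
by case: ifP => _; rewrite mul0r ?subr0 ?addr0.
Qed.

Lemma ler_abs_coord c x : `|scalar_coord c x| <= abs_scalar x.
Proof.
rewrite /scalar_coord /abs_scalar; case: k c x => //= c [a b] /=.
case: ifP => _;
  by rewrite -[leLHS]sqrtr_sqr ler_wsqrtr// ?lerDl ?lerDr sqr_ge0.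
Qed.

Lemma scalar_of_coordK (u : 'I_(real_degree k) -> R) c :
  scalar_coord c (scalar_of_coord u) = u c.
Proof.
rewrite /scalar_coord /scalar_of_coord; case: k u c => /= u c.
  by rewrite (ord1 c).
by case: eqVneq => [->//|c0]; congr u; apply/val_inj; case: c c0 => [[|[|]]].
Qed.

Lemma scalar_coordK x : scalar_of_coord (scalar_coord^~ x) = x.
Proof. by rewrite /scalar_coord /scalar_of_coord; case: k x => //= - [a b]. Qed.

Lemma scalar_of_coord_is_scalar r (u w : 'I_(real_degree k) -> R) :
  scalar_of_coord (fun c => r * u c + w c) =
  of_real r * scalar_of_coord u + scalar_of_coord w.
Proof.
rewrite -[RHS]scalar_coordK; congr scalar_of_coord; apply/funext => c.
by rewrite scalar_coord_is_scalar !scalar_of_coordK.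
Qed.

(** Makes conjugation a ring morphism, so that [map_mxM], [row_free_map] and [fmorph_eq0] apply to
    it. *)
Lemma conj_scalar_is_monoid_morphism : GRing.monoid_morphism conjF.
Proof.
rewrite /conj_scalar; case: k => //=; split; first exact: rmorph1.
exact: rmorphM.
Qed.

HB.instance Definition _ := GRing.isZmodMorphism.Build F F conjF
  (@conj_scalar_is_zmod_morphism R k).
HB.instance Definition _ := GRing.isMonoidMorphism.Build F F conjF
  conj_scalar_is_monoid_morphism.

Lemma mul_conj_ge0 x : 0 <= x * conjF x.
Proof.
rewrite /conj_scalar; case: k x => /= x; last exact: mul_conjC_ge0.
by rewrite -expr2 sqr_ge0.
Qed.

Lemma mul_conj_eq0 x : x * conjF x = 0 -> x = 0.
Proof.
by move=> /eqP; rewrite mulf_eq0 => /orP[/eqP//|]; rewrite fmorph_eq0 => /eqP.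
Qed.

End ScalarCoord.

(** * Real coordinates on Hermitian matrices with prescribed zeros *)

Section SymCoord.
Variables (R : realType) (k : base_field) (n : nat).
Local Notation F := (scalars R k).
Local Notation conjF := (@conj_scalar R k).
Local Notation of_real := (@of_real R k).
Local Notation "A ^*t" := (map_mx conjF A^T) (at level 8, format "A ^*t").

Lemma hermitianP (A : 'M[F]_n) : reflect (A^*t = A) (A \in @is_hermitian R k n).
Proof. by rewrite unfold_in is_hermitianmxE expr0 scale1r eq_sym; apply: eqP. Qed.

Lemma Sym_adjoint (A : Sym R k n) : A^*t = A.
Proof. by apply/hermitianP; exact: Sym_valP. Qed.

Lemma Sym_conj (A : Sym R k n) i j : conjF (A i j) = A j i.
Proof. by have /matrixP/(_ j i) := Sym_adjoint A; rewrite !mxE. Qed.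

Lemma Sym_scalarE (r : R) (A B : Sym R k n) i j :
  (r *: A + B) i j = of_real r * A i j + B i j.
Proof. by rewrite /= !mxE. Qed.

Variable P : pred ('I_n * 'I_n).

(** [P] selects the positions above the diagonal that may be nonzero: [predT] describes all of
    Sym(n), [off_block] the normal forms with a vanishing block. *)
Definition strict_upper : pred ('I_n * 'I_n) :=
  [pred u : 'I_n * 'I_n | (u.1 < u.2)%N & P u].

Definition sym_index : finType :=
  ({u | strict_upper u} * 'I_(real_degree k) + 'I_n)%type.

Definition sym_coord (c : sym_index) (A : 'M[F]_n) : R :=
  match c with
  | inl (u, c) => scalar_coord c (A (val u).1 (val u).2)
  | inr i => scalar_re (A i i)
  end.

(** A position below the diagonal is looked up at its mirror image and conjugated. Where both
    [insub] tests fail, [P] prescribes a zero. *)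
Definition sym_of_coord_mx (v : sym_index -> R) : 'M[F]_n :=
  \matrix_(i, j)
    if i == j then of_real (v (inr i))
    else if insub (i, j) is Some u then scalar_of_coord (fun c => v (inl (u, c)))
    else if insub (j, i) is Some u
    then conjF (scalar_of_coord (fun c => v (inl (u, c))))
    else 0.

Fact sym_of_coord_hermitian v : sym_of_coord_mx v \in @is_hermitian R k n.
Proof.
apply/hermitianP/matrixP => i j; rewrite !mxE eq_sym.
case: (eqVneq i j) => [->|_]; first by rewrite conj_of_real.
case: insubP => [u /andP[/= lji _] _|nji].
  case: insubP => [w /andP[/= lij _] _|//].
  by have := ltn_trans lij lji; rewrite ltnn.
by case: insubP => [w _ _|_]; rewrite ?conj_scalarK ?rmorph0.
Qed.

Definition sym_of_coord v : Sym R k n := MkSym (sym_of_coord_hermitian v).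

Lemma sym_of_coordK v c : sym_coord c (sym_of_coord v) = v c.
Proof.
case: c => [[u c]|i] /=; rewrite mxE ?eqxx ?scalar_reK//.
have /andP[/= lu _] := valP u.
rewrite -val_eqE ltn_eqF//= (_ : (_, _) = val u) ?valK ?scalar_of_coordK//.
exact: esym (surjective_pairing _).
Qed.

Lemma sym_of_coord_supp v (i j : 'I_n) :
  (i < j)%N -> ~~ P (i, j) -> sym_of_coord v i j = 0.
Proof.
move=> lij nP; rewrite mxE -val_eqE ltn_eqF//=.
rewrite insubN ?negb_and ?nP ?orbT// insubN// negb_and /= -leqNgt.
by rewrite (ltnW lij).
Qed.

Lemma sym_coordK (A : Sym R k n) :
  (forall i j : 'I_n, (i < j)%N -> ~~ P (i, j) -> A i j = 0) ->
  sym_of_coord (sym_coord^~ A) = A.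
Proof.
move=> A0; apply/val_inj/matrixP => i j /=; rewrite mxE.
have upper (x y : 'I_n) u : val u = (x, y) ->
    scalar_of_coord (fun c => sym_coord (inl (u, c)) A) = A x y.
  by move=> ux; rewrite /= ux scalar_coordK.
case: (eqVneq i j) => [<-|nij].
  by rewrite conj_scalar_fixed// Sym_conj.
case: insubP => [u _ /upper//|]; rewrite negb_and /= => nij1.
case: insubP => [u _ /upper->|]; rewrite ?Sym_conj// negb_and /= => nji1.
case: (ltngtP i j) nij1 nji1 nij => [lij|lji|/val_inj->] //=; last by rewrite eqxx.
- by move=> nP _ _; rewrite A0.
- by move=> _ nP _; rewrite -Sym_conj A0// rmorph0.
Qed.

Lemma sym_coord_is_scalar c (r : R) (A B : Sym R k n) :
  sym_coord c (r *: A + B) = r * sym_coord c A + sym_coord c B.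
Proof.
case: c => [[u c]|i] /=; rewrite !mxE.
  exact: scalar_coord_is_scalar.
exact: scalar_re_is_scalar.
Qed.

(** Linearity is inherited from [sym_coord]: the right-hand side respects the prescribed zeros, so
    it is recovered from its coordinates. *)
Lemma sym_of_coord_is_scalar (r : R) v w :
  sym_of_coord (fun c => r * v c + w c) = r *: sym_of_coord v + sym_of_coord w.
Proof.
rewrite -[RHS]sym_coordK.
  congr sym_of_coord; apply/funext => c.
  by rewrite sym_coord_is_scalar !sym_of_coordK.
by move=> i j lij nP; rewrite Sym_scalarE !sym_of_coord_supp// mulr0 addr0.
Qed.

(** The norm is the sum of the absolute values of all entries, hence dominates each of them. *)
Lemma ler_sym_coord c (A : Sym R k n) : `|sym_coord c A| <= `|A|.
Proof.
have entry i j : abs_scalar (A i j) <= `|A|.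
  rewrite [leRHS]/(Sym_norm A) /Sym_norm (bigD1 i)//= (bigD1 j)//= -addrA lerDl.
  rewrite addr_ge0// ?sumr_ge0// => *; rewrite ?abs_scalar_ge0//.
  by apply: sumr_ge0 => *; exact: abs_scalar_ge0.
case: c => [[u c]|i] /=; apply: le_trans (entry _ _).
  exact: ler_abs_coord.
exact: ler_abs_re.
Qed.

Definition sym_row (A : Sym R k n) : 'rV[R]_#|sym_index| :=
  \row_j sym_coord (enum_val j) A.

Definition row_sym (v : 'rV[R]_#|sym_index|) : Sym R k n :=
  sym_of_coord (fun c => v ord0 (enum_rank c)).

Fact sym_row_is_linear : linear sym_row.
Proof. by move=> r A B; apply/rowP => j; rewrite !mxE sym_coord_is_scalar. Qed.
HB.instance Definition _ :=
  GRing.isLinear.Build R (Sym R k n) 'rV[R]_#|sym_index| _ sym_row sym_row_is_linear.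

Fact row_sym_is_linear : linear row_sym.
Proof.
move=> r v w; rewrite -sym_of_coord_is_scalar; congr sym_of_coord.
by apply/funext => c; rewrite !mxE.
Qed.
HB.instance Definition _ :=
  GRing.isLinear.Build R 'rV[R]_#|sym_index| (Sym R k n) _ row_sym row_sym_is_linear.

Lemma row_symK : cancel row_sym sym_row.
Proof. by move=> v; apply/rowP => j; rewrite mxE sym_of_coordK enum_valK. Qed.

Lemma sym_rowK (A : Sym R k n) :
  (forall i j : 'I_n, (i < j)%N -> ~~ P (i, j) -> A i j = 0) ->
  row_sym (sym_row A) = A.
Proof.
move=> A0; rewrite -[RHS]sym_coordK//; congr sym_of_coord.
by apply/funext => c; rewrite mxE enum_rankK.
Qed.

Lemma sym_coord_continuous c : continuous (sym_coord c : Sym R k n -> R).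
Proof.
pose f : {linear Sym R k n -> R^o} :=
  HB.pack (sym_coord c : Sym R k n -> R^o)
    (GRing.isLinear.Build R (Sym R k n) R^o _ (sym_coord c : Sym R k n -> R^o)
       (sym_coord_is_scalar c)).
apply: (bounded_linear_continuous (f := f)); apply/linear_boundedP.
(* Boundedness asks for a bound by every large factor; here every [r] above 1 works. *)
exists 1; split=> //= r r1 A; apply: le_trans (ler_sym_coord c A) _.
by rewrite ler_peMl// ltW.
Qed.

Lemma sym_row_continuous : continuous sym_row.
Proof.
rewrite (_ : sym_row = fun A =>
    \sum_j sym_coord (enum_val j) A *: delta_mx ord0 j); last first.
  apply/funext => A; rewrite [LHS]row_sum_delta.
  by apply: eq_bigr => j _; rewrite mxE.
apply: continuous_sumr => j _ A.
apply: (@continuousZr_tmp _ _ _ (fun B : Sym R k n => sym_coord (enum_val j) B)).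
exact: sym_coord_continuous.
Qed.

Lemma card_sym_index :
  #|sym_index| = (real_degree k * #|strict_upper| + n)%N.
Proof. by rewrite card_sum card_prod card_sig !card_ord mulnC. Qed.

End SymCoord.

(** Factor [f] through the full coordinates ([P] is [predT]): they are continuous, and so is every
    linear map from a space of real rows. *)
Lemma Sym_linear_continuous (R : realType) (k : base_field) (n : nat)
    (W : normedModType R) (f : {linear Sym R k n -> W}) : continuous f.
Proof.
rewrite (_ : GRing.Linear.sort f =
    (f \o @row_sym R k n predT) \o @sym_row R k n predT).
  move=> A; apply: continuous_comp; first exact: sym_row_continuous.
  exact: (@linear_row_continuous _ _ _ (f \o @row_sym R k n predT)).
by apply/funext => A /=; rewrite sym_rowK.
Qed.

(** * Continuity of scalar-valued maps, coordinate by coordinate *)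

Section CoordContinuous.
Variables (R : realType) (k : base_field) (T : topologicalType).
Local Notation F := (scalars R k).
Implicit Types f g : T -> F.

(* Continuity for the topology of [scalars R k] as a real vector space. *)
Definition scalar_continuous f := forall c, continuous (scalar_coord c \o f).

Lemma scalar_continuous_cst x : scalar_continuous (cst x).
Proof. by move=> c t; exact: cvg_cst. Qed.

Lemma scalar_continuousD f g : scalar_continuous f -> scalar_continuous g ->
  scalar_continuous (fun t => f t + g t).
Proof.
move=> cf cg c; rewrite (_ : _ \o _ =
    fun t => scalar_coord c (f t) + scalar_coord c (g t)); last first.
  apply/funext => t /=.
  by rewrite -[X in X + g t]mul1r -(of_real1 R k) scalar_coord_is_scalar mul1r.
by move=> t; apply: cvgD; [exact: cf|exact: cg].
Qed.

Lemma scalar_continuous_sum (I : Type) (r : seq I) (f : I -> T -> F) :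
  (forall i, scalar_continuous (f i)) ->
  scalar_continuous (fun t => \sum_(i <- r) f i t).
Proof.
move=> cf; elim: r => [|i r IH].
  rewrite (_ : (fun _ => _) = cst 0); first exact: scalar_continuous_cst.
  by apply/funext => t; rewrite big_nil.
rewrite (_ : (fun _ => _) = fun t => f i t + \sum_(j <- r) f j t).
  exact: scalar_continuousD.
by apply/funext => t; rewrite big_cons.
Qed.

End CoordContinuous.

(** The real and imaginary parts of a complex product are polynomials in those of the factors. *)
Lemma scalar_continuousM (R : realType) (k : base_field) (T : topologicalType)
    (f g : T -> scalars R k) : scalar_continuous f -> scalar_continuous g ->
  scalar_continuous (fun t => f t * g t).
Proof.
case: k f g => /= f g cf cg c t.
  by apply: (@cvgM R T); [exact: (cf c)|exact: (cg c)].
have [cr ci] := (cf ord0, cf ord_max); have [dr di] := (cg ord0, cg ord_max).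
have [c0|c1] := eqVneq c ord0.
- rewrite (_ : _ \o _ = fun t => complex.Re (f t) * complex.Re (g t)
      - complex.Im (f t) * complex.Im (g t)).
    by apply: cvgB; apply: cvgM;
      [exact: cr|exact: dr|exact: ci|exact: di].
  by apply/funext => s; rewrite c0 /=; case: (f s) (g s) => [? ?] [].
- rewrite (_ : _ \o _ = fun t => complex.Re (f t) * complex.Im (g t)
      + complex.Im (f t) * complex.Re (g t)).
    by apply: cvgD; apply: cvgM;
      [exact: cr|exact: di|exact: ci|exact: dr].
  by apply/funext => s; rewrite /= (negPf c1); case: (f s) (g s) => [? ?] [].
Qed.

(** * Determinants, and lower semicontinuity of the rank *)

Section RankOpen.
Variables (R : realType) (k : base_field) (T : topologicalType).
Local Notation F := (scalars R k).

Lemma scalar_continuous_prod (I : Type) (r : seq I) (f : I -> T -> F) :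
  (forall i, scalar_continuous (f i)) ->
  scalar_continuous (fun t => \prod_(i <- r) f i t).
Proof.
move=> cf; elim: r => [|i r IH].
  rewrite (_ : (fun _ => _) = cst 1); first exact: scalar_continuous_cst.
  by apply/funext => t; rewrite big_nil.
rewrite (_ : (fun _ => _) = fun t => f i t * \prod_(j <- r) f j t).
  exact: scalar_continuousM.
by apply/funext => t; rewrite big_cons.
Qed.

Definition mx_continuous m n (Q : T -> 'M[F]_(m, n)) :=
  forall i j, scalar_continuous (fun t => Q t i j).

Lemma mx_continuous_cst m n (B : 'M[F]_(m, n)) : mx_continuous (cst B).
Proof. by move=> i j; exact: scalar_continuous_cst. Qed.

Lemma mx_continuousM m n r (Q : T -> 'M[F]_(m, n)) (S : T -> 'M[F]_(n, r)) :
  mx_continuous Q -> mx_continuous S -> mx_continuous (fun t => Q t *m S t).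
Proof.
move=> cQ cS i j; rewrite (_ : (fun _ => _) = fun t => \sum_l Q t i l * S t l j).
  by apply: scalar_continuous_sum => l; exact: scalar_continuousM.
by apply/funext => t; rewrite mxE.
Qed.

(** By the Leibniz formula, the determinant is a sum over permutations of products of entries. *)
Lemma scalar_continuous_det n (Q : T -> 'M[F]_n) :
  mx_continuous Q -> scalar_continuous (fun t => \det (Q t)).
Proof.
move=> cQ; apply: scalar_continuous_sum => s; apply: scalar_continuousM.
  exact: scalar_continuous_cst.
by apply: scalar_continuous_prod => i; exact: cQ.
Qed.

(** A scalar is nonzero exactly when one of its real coordinates is, so the set is a union of open
    preimages. *)
Lemma open_scalar_neq0 (f : T -> F) :
  scalar_continuous f -> open [set t | f t != 0].
Proof.
move=> cf; rewrite (_ : [set _ | _] =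
    \bigcup_(c in setT) ((scalar_coord c \o f) @^-1` [set x | x != 0])).
  apply: bigcup_open => c _; apply: open_comp; first by move=> t _; exact: cf.
  exact: open_neq.
have coord0 c : scalar_coord c (0 : F) = 0.
  apply: (@addrI _ (scalar_coord c (0 : F))); rewrite addr0.
  by have := scalar_coord_is_scalar c 1 (0 : F) 0; rewrite mulr0 addr0 mul1r.
apply/seteqP; split=> t /= => [ft0|[c _]]; last first.
  by move=> /=; apply: contra_neq => ->.
apply: contrapT => fc0; case/eqP: ft0; rewrite -[f t]scalar_coordK -[RHS]scalar_coordK.
congr scalar_of_coord; apply/funext => c; rewrite coord0.
by apply: contrapT => /eqP fc; apply: fc0; exists c.
Qed.

(* Near [t] the rank can only go up, because a two-sided compression of [Q t] to
   an invertible matrix of size [\rank (Q t)] stays invertible. *)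
Lemma open_rank_ge m n (Q : T -> 'M[F]_(m, n)) r :
  mx_continuous Q -> open [set t | (r <= \rank (Q t))%N].
Proof.
move=> cQ; rewrite openE => t /= rt; rewrite /interior.
have /row_freeP[B BE] := row_base_free (Q t).
have /row_fullP[C CE] := col_base_full (Q t).
pose h u := \det (C *m Q u *m B).
have oh : open [set u | h u != 0].
  apply/open_scalar_neq0/scalar_continuous_det/mx_continuousM.
    by apply: mx_continuousM => //; exact: mx_continuous_cst.
  exact: mx_continuous_cst.
apply: (@filterS _ _ _ [set u | h u != 0]); last first.
  apply: open_nbhs_nbhs; split=> //=.
  have CQ : C *m Q t = row_base (Q t).
    by rewrite -[RHS]mul1mx -CE -mulmxA mulmx_base.
  by rewrite /h CQ BE det1 oner_neq0.
move=> u /= hu; apply: leq_trans rt _.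
have : C *m Q u *m B \in unitmx by rewrite unitmxE unitfE.
rewrite -row_full_unit => /eqP <-.
by apply: leq_trans (mxrankM_maxl _ _) (mxrankM_maxr _ _).
Qed.

End RankOpen.

(** * Counting positions above the diagonal *)

Section StrictUpperCard.
Local Open Scope nat_scope.

Lemma card_ord_lt m n : m <= n -> #|[pred i : 'I_n | i < m]| = m.
Proof.
move=> mn.
by rewrite -sum1_card -(big_ord_widen n (fun=> 1) mn) sum1_card card_ord.
Qed.

Lemma card_ord_interval m1 m2 n : m1 <= m2 <= n ->
  #|[pred i : 'I_n | m1 <= i < m2]| = m2 - m1.
Proof.
move=> /andP[m12 m2n].
rewrite -[in RHS](card_ord_lt m2n).
rewrite -(cardID [pred i : 'I_n | i < m1] [pred i : 'I_n | i < m2]).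
rewrite (@eq_card _ [predI _ & _] [pred i : 'I_n | i < m1]) => [|i]; last first.
  by rewrite !inE; apply: andb_idl => im1; exact: leq_trans m12.
rewrite card_ord_lt ?(leq_trans m12)// addKn; apply: eq_card => i.
by rewrite !inE -leqNgt.
Qed.

(** Column [j], counted from 0, has [j] positions above the diagonal; summing over the columns gives
    a binomial coefficient. *)
Lemma card_strict_upperT n : #|strict_upper (n := n) predT| = (n * n.-1)./2.
Proof.
rewrite -bin2 -bin2_sum big_mkord -sum1_card.
rewrite (eq_bigl (fun u : 'I_n * 'I_n => true && (u.1 < u.2))); last first.
  by move=> u; rewrite !inE /= andbT.
rewrite -(pair_big_dep xpredT (fun i j : 'I_n => i < j) (fun _ _ => 1))/=.
rewrite (exchange_big_dep xpredT)//=; apply: eq_bigr => j _.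
by rewrite sum1_card (@eq_card _ _ [pred i : 'I_n | i < j])// card_ord_lt// ltnW.
Qed.

Definition off_block p r n : pred ('I_n * 'I_n) :=
  [pred u : 'I_n * 'I_n | ~~ ((u.1 < p) && (p <= u.2 < p + r))].

(** The excluded block has row indices below [p] and column indices at least [p], so it lies wholly
    above the diagonal and removes exactly [p * r] positions. *)
Lemma card_strict_upper_off_block p r n : p + r <= n ->
  #|strict_upper (@off_block p r n)| = (n * n.-1)./2 - p * r.
Proof.
move=> prn; rewrite -card_strict_upperT.
rewrite -(cardID (@off_block p r n) (strict_upper predT)).
rewrite (@eq_card _ [predI strict_upper predT & _]
  (strict_upper (@off_block p r n))); last first.
  by move=> u; rewrite !inE /= andbT andbC.
rewrite (@eq_card _ [predD _ & _]
  [predX [pred i : 'I_n | i < p] & [pred i : 'I_n | p <= i < p + r]]); last first.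
  move=> [i j]; rewrite !inE /= negbK andbT; apply: andb_idr => /and3P[/= ip pj _].
  exact: leq_trans pj.
rewrite cardX card_ord_lt ?(leq_trans _ prn) ?leq_addr//.
by rewrite card_ord_interval ?leq_addr// addKn addnK.
Qed.

End StrictUpperCard.

(** * Adjoints, Gram matrices and congruence *)

Section Adjoint.
Variables (R : realType) (k : base_field).
Local Notation F := (scalars R k).
Local Notation conjF := (@conj_scalar R k).
Local Notation "A ^*t" := (map_mx conjF A^T) (at level 8, format "A ^*t").

Lemma adjointM m n p (A : 'M[F]_(m, n)) (B : 'M[F]_(n, p)) :
  (A *m B)^*t = B^*t *m A^*t.
Proof. by rewrite trmx_mul map_mxM. Qed.

Lemma adjointK m n (A : 'M[F]_(m, n)) : A^*t^*t = A.
Proof. by apply/matrixP => i j; rewrite !mxE conj_scalarK. Qed.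

(** The product is a sum of terms [x * conjF x], nonnegative in the partial order of [F], so each
    term vanishes. *)
Lemma mul_adjoint_eq0 n (v : 'rV[F]_n) : v *m v^*t = 0 -> v = 0.
Proof.
move=> /matrixP/(_ ord0 ord0); rewrite !mxE => vv0; apply/rowP => j.
rewrite mxE; apply: mul_conj_eq0.
have ge0 i : true -> 0 <= v ord0 i * v^*t i ord0.
  by move=> _; rewrite !mxE mul_conj_ge0.
by have /(_ j isT) := psumr_eq0P ge0 vv0; rewrite !mxE.
Qed.

(** If [v] kills the Gram matrix, then [v *m A] times its own adjoint is zero; definiteness and then
    freeness give [v = 0]. *)
Lemma gram_unitmx m n (A : 'M[F]_(m, n)) : row_free A -> A *m A^*t \in unitmx.
Proof.
move=> fA; rewrite -row_free_unit; apply: inj_row_free => v vAA0.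
have /mul_adjoint_eq0/eqP : (v *m A) *m (v *m A)^*t = 0.
  by rewrite adjointM mulmxA -(mulmxA v) vAA0 mul0mx.
by rewrite mulmx_free_eq0// => /eqP.
Qed.

(** By Gaussian elimination [A] is an invertible matrix times the first [m] rows of the invertible
    [row_ebase A]; the other [s] rows complete it. *)
Lemma row_free_complete m s (A : 'M[F]_(m, m + s)) :
  row_free A -> exists B : 'M[F]_(s, m + s), col_mx A B \in unitmx.
Proof.
move=> /eqP rA; exists (dsubmx (row_ebase A)).
have AE : A = col_ebase A *m usubmx (row_ebase A).
  rewrite -{1}(mulmx_ebase A) rA -{1}(vsubmxK (row_ebase A)) pid_mx_row -mulmxA.
  by rewrite mul_row_col mul1mx mul0mx addr0.
rewrite {1}AE (_ : col_mx _ _ =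
    block_mx (col_ebase A) 0 0 1%:M *m row_ebase A).
  rewrite unitmx_mul row_ebase_unit andbT unitmxE det_ublock det1 mulr1.
  by rewrite -unitmxE col_ebase_unit.
by rewrite -[in RHS](vsubmxK (row_ebase A)) mul_block_col !mul0mx mul1mx addr0 add0r.
Qed.

Lemma congruence_hermitian n (W : 'M[F]_n) (A : Sym R k n) :
  W *m A *m W^*t \in @is_hermitian R k n.
Proof. by apply/hermitianP; rewrite !adjointM adjointK Sym_adjoint mulmxA. Qed.

Definition congruence n (W : 'M[F]_n) (A : Sym R k n) : Sym R k n :=
  MkSym (congruence_hermitian W A).

Fact congruence_is_linear n (W : 'M[F]_n) : linear (congruence W).
Proof.
move=> r A B; apply/val_inj => /=.
by rewrite mulmxDr mulmxDl -scalemxAr -scalemxAl.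
Qed.
HB.instance Definition _ n (W : 'M[F]_n) :=
  GRing.isLinear.Build R (Sym R k n) (Sym R k n) _ (congruence W)
    (congruence_is_linear W).

Lemma congruenceM n (W1 W2 : 'M[F]_n) A :
  congruence W1 (congruence W2 A) = congruence (W1 *m W2) A.
Proof. by apply/val_inj => /=; rewrite adjointM !mulmxA. Qed.

Lemma congruence1 n (A : Sym R k n) : congruence 1%:M A = A.
Proof. by apply/val_inj => /=; rewrite trmx1 map_mx1 mul1mx mulmx1. Qed.

End Adjoint.

Lemma Sym_entry_continuous (R : realType) (k : base_field) (n : nat) i j :
  scalar_continuous (fun A : Sym R k n => A i j).
Proof.
move=> c; pose h (A : Sym R k n) : R^o := scalar_coord c (A i j).
have hlin : linear h by move=> r A B; rewrite /h Sym_scalarE scalar_coord_is_scalar.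
pose f : {linear Sym R k n -> R^o} :=
  HB.pack h (GRing.isLinear.Build R (Sym R k n) R^o _ h hlin).
exact: (Sym_linear_continuous (f := f)).
Qed.

(** * The submanifold and a member of it, in terms of row spaces *)

Section MsymRows.
Variables (R : realType) (k : base_field).
Local Notation F := (scalars R k).
Local Notation conjF := (@conj_scalar R k).
Local Notation "A ^*t" := (map_mx conjF A^T) (at level 8, format "A ^*t").

(** In a relation between the first two blocks, multiplying by the conjugate of [Y] kills the part
    from [X] and leaves the coefficients [b] times the Gram matrix of [Y^T]. So [b] vanishes, then
    [a] by freeness of [X]. *)
Lemma adapted_unitmx p r q (X : 'M[F]_(p, p + r + q))
    (Y : 'M[F]_(p + r + q, r)) :
  row_free X -> row_free Y^T -> X *m Y = 0 ->
  exists W : 'M[F]_(q, p + r + q),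
    col_mx (col_mx (map_mx conjF X) Y^T) W \in unitmx.
Proof.
move=> fX fY XY0; apply/row_free_complete/inj_row_free => v.
rewrite -(hsubmxK v) mul_row_col; set a := lsubmx v; set b := rsubmx v => ab0.
have b0 : b = 0.
  have /(congr1 (mulmxr Y^T^*t))/= := ab0.
  rewrite mulmxDl -!mulmxA trmxK -map_mxM XY0 map_mx0 mulmx0 add0r mul0mx => bY0.
  have := gram_unitmx fY; rewrite trmxK => uY.
  by rewrite -[b](mulmxK uY) bY0 mul0mx.
move: ab0; rewrite b0 mul0mx addr0 => /eqP.
by rewrite mulmx_free_eq0 ?row_free_map// => /eqP ->; rewrite row_mx0.
Qed.

(** The rows of [X] and [Z] stand for S and S', and [Y] gives equations of S'. The splitting of [n]
    is a hypothesis, so that matrices of width [n] can be supplied without casts. *)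
Lemma embedded_submanifold_rows n p q r m (X : 'M[F]_(p, n)) (Y : 'M[F]_(n, r))
    (Z : 'M[F]_(m, n)) :
  n = (p + r + q)%N -> row_free X -> row_free Y^T -> (X <= Z)%MS ->
  (forall l (v : 'M[F]_(l, n)), (v <= Z)%MS = (v *m Y == 0)) ->
  embedded_submanifold
    [set A : Sym R k n | (col_mx X (X *m A^T) == Z)%MS]
    (real_degree k * ((n * n.-1)./2 - p * r) + n)%N.
Proof.
move=> nE; subst n; move=> fX fY XZ ZY.
have XY0 : X *m Y = 0 by apply/eqP; rewrite -ZY.
have [V uW] := adapted_unitmx fX fY XY0; set W := col_mx _ V in uW.
set n := (p + r + q)%N.
have WX i l : W (lshift q (lshift r i)) l = conjF (X i l).
  by rewrite !col_mxEu mxE.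
have WY j l : W (lshift q (rshift p j)) l = Y l j.
  by rewrite col_mxEu col_mxEd mxE.
(* From here on [W] is known only through its first [p + r] rows and its invertibility. *)
clearbody W.
(* The off-diagonal block of the congruent matrix is the conjugate of [X *m A^T *m Y], since
   conjugating [A^T] gives back [A]. *)
have blockE (A : Sym R k n) i j :
    congruence W A (lshift q (lshift r i)) (lshift q (rshift p j)) =
    conjF ((X *m A^T *m Y) i j).
  rewrite 2!mxE rmorph_sum; apply: eq_bigr => l _.
  rewrite !mxE rmorphM rmorph_sum WY; congr (_ * _); apply: eq_bigr => l' _.
  by rewrite rmorphM/= WX mxE Sym_conj.
pose P := @off_block p r n.
(* [g] fills in a matrix with zero block and undoes the congruence; [f], defined on all of Sym(n),
   ignores the block. *)
pose f : {linear _ -> _} := @sym_row R k n P \o congruence W.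
pose g : {linear _ -> _} := congruence (invmx W) \o @row_sym R k n P.
have fE A : f A = sym_row P (congruence W A) by [].
have gE v : g v = congruence (invmx W) (row_sym v) by [].
have gK : cancel g f.
  by move=> v; rewrite fE gE congruenceM mulmxV// congruence1 row_symK.
have range_g A : range g A <-> (X *m A^T <= Z)%MS.
  rewrite ZY; split=> [[v _ <-]|/eqP A0].
    apply/eqP/matrixP => i j; apply: (can_inj (@conj_scalarK R k)).
    rewrite -blockE gE congruenceM mulmxV// congruence1 [in RHS]mxE rmorph0.
    rewrite sym_of_coord_supp//=; first by rewrite ltn_addr.
    by rewrite negbK/= ltn_ord leq_addr ltn_add2l ltn_ord.
  exists (f A) => //; rewrite gE fE sym_rowK.
    by rewrite congruenceM mulVmx// congruence1.
  move=> i j _; rewrite negbK /= => /andP[ip /andP[pj jr]].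
  have -> : i = lshift q (lshift r (Ordinal ip)) by exact/val_inj.
  have jp : (j - p < r)%N by rewrite ltn_subLR.
  have -> : j = lshift q (rshift p (Ordinal jp)) by apply/val_inj; rewrite /= subnKC.
  by rewrite blockE A0 mxE rmorph0.
(* On the range of [g] the row space is contained in that of [Z], so equality reduces to a rank
   inequality. *)
have -> : [set A : Sym R k n | (col_mx X (X *m A^T) == Z)%MS] =
    range g `&` [set A : Sym R k n | (\rank Z <= \rank (col_mx X (X *m A^T)))%N].
  apply/seteqP; split=> A /=.
    move=> AZ; split; last by rewrite (eqmxP AZ).
    by apply/range_g; rewrite -(eqmxP AZ) -addsmxE addsmxSr.
  move=> [/range_g XAZ rk]; have XAZ' : (col_mx X (X *m A^T) <= Z)%MS.
    by rewrite col_mx_sub XZ.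
  by rewrite -(mxrank_leqif_eq XAZ') eqn_leq mxrankS.
rewrite -card_strict_upper_off_block ?leq_addr// -card_sym_index.
apply: linear_embedded_submanifold gK _; first exact: Sym_linear_continuous.
apply: open_rank_ge => i j; case: (split_ordP i) => l ->.
  rewrite (_ : (fun _ => _) = cst (X l j)); first exact: scalar_continuous_cst.
  by apply/funext => A; rewrite col_mxEu.
rewrite (_ : (fun _ => _) = fun A : Sym R k n => (X *m A^T) l j).
  apply: mx_continuousM => [|a b]; first exact: mx_continuous_cst.
  rewrite (_ : (fun _ => _) = fun A : Sym R k n => A b a).
    exact: Sym_entry_continuous.
  by apply/funext => A; rewrite mxE.
by apply/funext => A; rewrite col_mxEd.
Qed.

(** With [G] the Gram matrix of [X], the product [X *m A^T] is [G *m C *m T] plus a term [H] with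
    rows in the row space of [X]. The bound on [t] lets [C] have rank [t], so that [G *m C] has a
    left inverse and nothing of [T] is lost. *)
Lemma exists_adjoint_rows n p t (X : 'M[F]_(p, n)) (T : 'M[F]_(t, n)) :
  row_free X -> (t <= p)%N ->
  exists A : Sym R k n, (col_mx X (X *m A^T) == col_mx X T)%MS.
Proof.
move=> fX tp; pose C : 'M[F]_(p, t) := pid_mx t; pose B := X^*t *m C *m T.
have hB : (B + B^*t)^T \in @is_hermitian R k n.
  by apply/hermitianP/matrixP => i j; rewrite !mxE rmorphD/= conj_scalarK addrC.
exists (MkSym hB); rewrite /= trmxK mulmxDr adjointM adjointM adjointK.
have uG := gram_unitmx fX; set G := X *m X^*t in uG.
rewrite !mulmxA -/G; set H := X *m _ *m _ *m X.
have HX : (H <= X)%MS by rewrite submxMl.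
clearbody G.
have CT : (G *m C *m T :=: T)%MS.
  apply/eqmxP; rewrite submxMl/=; apply/submxP.
  (* This is a left inverse of [G *m C]. *)
  exists (pid_mx t *m invmx G); rewrite !mulmxA mulmxKV// mul_pid_mx.
  by rewrite minnn (minn_idPr tp) pid_mx_1 mul1mx.
apply/andP; split; rewrite col_mx_sub; apply/andP; split.
- by rewrite -addsmxE addsmxSl.
- rewrite -addsmxE addmx_sub//; first by rewrite CT addsmxSr.
  exact: submx_trans HX (addsmxSl _ _).
- by rewrite -addsmxE addsmxSl.
(* The rows of [T] are reached by subtracting [H], which [X] already spans. *)
- rewrite -addsmxE -CT -{1}[G *m C *m T](addrK H) addmx_sub//.
    exact: addsmxSr.
  by rewrite eqmx_opp (submx_trans HX) ?addsmxSl.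
Qed.

End MsymRows.

(** * From subspaces of column vectors to row spaces *)

Section RowBasis.
Variables (K : fieldType) (n : nat).
Implicit Types U V : {vspace 'cV[K]_n}.

(** Basis vectors are transposed to give access to the row-space calculus; a matrix [A] then acts on
    the right as [A^T]. *)
Definition row_basis U : 'M[K]_(\dim U, n) := \matrix_i ((vbasis U)`_i)^T.

Lemma mul_row_basis U (v : 'rV_(\dim U)) :
  (v *m row_basis U)^T = \sum_i v ord0 i *: (vbasis U)`_i.
Proof.
rewrite mulmx_sum_row linear_sum; apply: eq_bigr => i _.
by rewrite linearZ/= rowK trmxK.
Qed.

Lemma row_basis_free U : row_free (row_basis U).
Proof.
apply: inj_row_free => v v0; apply/rowP => i; rewrite mxE.
have /freeP/(_ (v ord0)) := basis_free (vbasisP U).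
by rewrite -mul_row_basis v0 trmx0 => /(_ erefl).
Qed.

Lemma memv_row_basis U (v : 'cV_n) : (v \in U) = (v^T <= row_basis U)%MS.
Proof.
apply/idP/submxP => [vU|[w vE]].
  exists (\row_i coord (vbasis U) i v); apply: trmx_inj; rewrite trmxK mul_row_basis.
  by rewrite {1}(coord_vbasis vU); apply: eq_bigr => i _; rewrite mxE.
rewrite -[v]trmxK vE mul_row_basis; apply: memv_suml => i _.
by rewrite memvZ// vbasis_mem// mem_nth// size_tuple.
Qed.

Lemma row_basisS U V : (U <= V)%VS -> (row_basis U <= row_basis V)%MS.
Proof.
move=> /subvP UV; apply/row_subP => i; rewrite rowK -memv_row_basis UV//.
by rewrite vbasis_mem// mem_nth// size_tuple.
Qed.

End RowBasis.

(** Transposing a vector of S + A S gives a combination of the rows of [row_basis S] and of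
    [row_basis S *m A^T], and conversely. *)
Lemma Msym_rows (R : realType) (k : base_field) (n : nat)
    (S S' : {vspace 'cV[scalars R k]_n}) :
  Msym S S' = [set A : Sym R k n |
    (col_mx (row_basis S) (row_basis S *m A^T) == row_basis S')%MS].
Proof.
apply/seteqP.
have memE (A : Sym R k n) (v : 'cV_n) : (v \in S + mulmx_image A S)%VS =
    (v^T <= col_mx (row_basis S) (row_basis S *m A^T))%MS.
  rewrite -addsmxE; apply/memv_addP/sub_addsmxP.
    move=> [u uS [_ /memv_imgP[w wS ->] ->]]; rewrite lfunE/= linearD/= trmx_mul.
    move: uS wS; rewrite !memv_row_basis => /submxP[a ->] /submxP[b ->].
    by exists (a, b); rewrite /= mulmxA.
  move=> [[a b]/= vE]; exists (a *m row_basis S)^T.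
    by rewrite memv_row_basis trmxK submxMl.
  exists ((A : 'M[scalars R k]_n) *m (b *m row_basis S)^T).
    apply/memv_imgP; exists (b *m row_basis S)^T; last by rewrite lfunE.
    by rewrite memv_row_basis trmxK submxMl.
  by apply: trmx_inj; rewrite vE linearD/= trmxK trmx_mul trmxK mulmxA.
split=> A /=.
  by move=> AS; apply/rV_eqP => v; rewrite -[v]trmxK -memE AS memv_row_basis.
by move=> /rV_eqP AS; apply/vspaceP => v; rewrite memE AS memv_row_basis.
Qed.

Theorem lemma5p11 (R : realType) (k : base_field) (n : nat)
    (S S' : {vspace 'cV[scalars R k]_n}) (p q : nat) :
  (1 <= n)%N ->
  (S <= S')%VS ->
  p = \dim S ->
  q = (\dim S' - \dim S)%N ->
  (q <= p)%N ->
  let alpha := real_degree k in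
  [/\ diffeomorphic (Sym R k n) 'rV[R]_(alpha * (n * n.-1)./2 + n)%N,
      Msym S S' !=set0 &
      embedded_submanifold (Msym S S')
        (alpha * ((n * n.-1)./2 - p * (n - p - q)) + n)%N].
Proof.
move=> _ SS' pE qE qp alpha; split.
- rewrite -card_strict_upperT -card_sym_index.
  apply: (@linear_diffeomorphic _ _ _ (@sym_row R k n predT) (@row_sym R k n predT)).
  + exact: sym_row_continuous.
  + exact: linear_row_continuous.
  + by move=> A; exact: sym_rowK.
  + exact: row_symK.
(* The rows of [T] are a basis of a complement of S in S', hence [q] in number. *)
- pose T := row_base (row_basis S' :\: row_basis S)%MS.
  have rT : \rank (row_basis S' :\: row_basis S)%MS = q.
    have := mxrank_cap_compl (row_basis S') (row_basis S).
    rewrite (capmx_idPr (row_basisS SS')) (eqP (row_basis_free S)).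
    by rewrite (eqP (row_basis_free S')) qE => /(canRL (addKn _)).
  have [|A AE] := exists_adjoint_rows T (row_basis_free S).
    by rewrite rT -pE.
  exists A; rewrite Msym_rows /=; apply/eqmxP/(eqmx_trans (eqmxP AE))/eqmxP.
  rewrite -addsmxE addsmx_sub row_basisS// eq_row_base diffmxSl/=.
  rewrite -{1}(addsmx_diff_cap_eq (row_basis S') (row_basis S)) addsmx_sub.
  rewrite -!addsmxE (submx_trans _ (addsmxSr _ _)) ?eq_row_base//=.
  exact: submx_trans (capmxSr _ _) (addsmxSl _ _).
- have dn : (\dim S' <= n)%N.
    by rewrite -(eqP (row_basis_free S')) rank_leq_col.
  (* The cokernel matrix cuts out S' but is square; its column base keeps only as many independent
     equations as the codimension of S'. *)
  pose Z := row_basis S'; pose Y := col_base (cokermx Z).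
  have rY : \rank (cokermx Z) = (n - p - q)%N.
    rewrite mxrank_coker (eqP (row_basis_free _)).
    by rewrite pE qE -subnDA subnKC// dimvS.
  rewrite Msym_rows -rY pE.
  apply: (@embedded_submanifold_rows _ _ _ _ q _ _ _ Y).
  (* The two inequalities between dimensions keep the subtractions from truncating. *)
  + by move: dn (dimvS SS'); rewrite rY qE -pE => ? ?; lia.
  + exact: row_basis_free.
  + rewrite /row_free mxrank_tr; exact: col_base_full.
  + exact: row_basisS.
  (* The cokernel is [Y] times a row-free factor, which cancels on the right. *)
  + move=> l v; rewrite submxE -[in LHS](mulmx_base (cokermx Z)) mulmxA.
    by rewrite mulmx_free_eq0 ?row_base_free.
Qed.
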